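(* Let $\mathcal{P}_1$ and $\mathcal{P}_2$ be polynomial systems with the same zero set $S$. Assume that $\mathcal{P}_1$ is $\text{SoS}_\varepsilon$-complete over $S$ and that $\mathcal{P}_2$ is explicitly Archimedean. If $\mathcal{P}_1\lesssim_{SoS}\mathcal{P}_2$, then $\mathcal{P}_2$ is $\text{SoS}_\varepsilon$-complete over $S$.
   Context: Polynomials in $x_1,\dots,x_n$; $d$ fixed, bounds as $n\to\infty$. Standing assumptions on the systems: every polynomial has degree $O(d)$ and each system has bit complexity polynomial in $n$ (so it has $\mathrm{poly}(n)$ polynomials with coefficients bounded by $2^{\mathrm{poly}(n^d)}$); $S$ is finite. An SoS proof of ''$q\ge0$'' from $\mathcal{P}=\{p_i=0\}$ is an identity $q=\sum s_i^2+\sum h_ip_i$, of degree $\max(\deg s_i^2,\deg h_ip_i)$; ''coefficients bounded by $B$'' means all coefficients of the $s_i,h_i$ have absolute value at most $B$. $\mathcal{P}$ is explicitly Archimedean if for every $i\in[n]$ there is $0<N\le2^{\mathrm{poly}(n^d)}$ with an SoS proof of ''$N-x_i^2\ge0$'' from $\mathcal{P}$ of degree $O(d)$ and coefficients bounded by $2^{\mathrm{poly}(n^d)}$ (equivalently, every degree-$t$ polynomial $p$ is bounded above by some $N_p\le 2^{\mathrm{poly}(n^{\max(t,d)},\lg\|p\|_\infty)}$ with such an SoS proof of ''$N_p-p\ge0$'' of degree $O(t)$). $\mathcal{P}$ is $\text{SoS}_\varepsilon$-complete over $S$ if for every polynomial $q$ of degree $\le2d$ vanishing on $S$ and every $\varepsilon>0$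 there is an SoS proof of ''$q+\varepsilon\ge0$'' from $\mathcal{P}$ of degree $O(d)$ with coefficients bounded by $2^{\mathrm{poly}(n^d,\lg\|q\|_\infty,\lg\frac1\varepsilon)}$. For systems $\mathcal{P},\mathcal{P}'$ with $V(\mathcal{P})=V(\mathcal{P}')$, $\mathcal{P}\lesssim_{SoS}\mathcal{P}'$ means: for every $p\in\mathcal{P}$ and $\varepsilon>0$ there are SoS proofs of ''$p+\varepsilon\ge0$'' and ''$-p+\varepsilon\ge0$'' from $\mathcal{P}'$ of degree $O(d)$ with coefficients bounded by $2^{\mathrm{poly}(n^d,\lg\frac1\varepsilon)}$. *)

(* Defs.v *)
From mathcomp Require Import all_boot all_order all_algebra.
From mathcomp Require Import mpoly.
From mathcomp Require Import classical_sets cardinality reals exp.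

Set Implicit Arguments.
Unset Strict Implicit.
Unset Printing Implicit Defensive.

Import Order.TTheory GRing.Theory Num.Theory.

Local Open Scope ring_scope.

(* Total degree; [msize] is the degree plus one, and 0 for the zero polynomial,
   whose degree is 0 here. *)
Definition mpdeg (R : realType) (n : nat) (p : {mpoly R[n]}) : nat :=
  (msize p).-1.

Definition coef_bounded (R : realType) (n : nat) (B : R) (p : {mpoly R[n]}) :
    Prop :=
  forall m : 'X_{1..n}, `|p@_m| <= B.

Definition coef_norm (R : realType) (n : nat) (p : {mpoly R[n]}) : R :=
  \big[Num.max/0]_(m <- msupp p) `|p@_m|.

(* Binary logarithm truncated at 0, so that polynomials in it are monotone
   bounds also when the argument is below 1 (in particular, is 0). *)
Definition lg (R : realType) (x : R) : R := Num.max 0 (ln x / ln 2).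

(* A function of nonnegative quantities x_1, ..., x_k is poly(x_1, ..., x_k)
   iff it is at most c (1 + x_1 + ... + x_k)^c for some constant c; one constant
   serves as both factor and exponent without loss of generality. *)
Definition poly_bound (R : realType) (c : nat) (xs : seq R) : R :=
  c%:R * (1 + \sum_(x <- xs) x) ^+ c.

Definition zeros (R : realType) (n : nat) (P : seq {mpoly R[n]}) :
    set ('I_n -> R) :=
  [set x | forall p, p \in P -> p.@[x] = 0]%classic.

(* An SoS proof of "q >= 0" from the equations p = 0, p in P, of degree at most
   D and with coefficients bounded by B. *)
Definition sos_proof (R : realType) (n : nat) (P : seq {mpoly R[n]})
    (q : {mpoly R[n]}) (D : nat) (B : R) : Prop :=
  exists (s : seq {mpoly R[n]}) (h : 'I_(size P) -> {mpoly R[n]}),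
    [/\ q = \sum_(t <- s) t ^+ 2 + \sum_(i < size P) h i * P`_i,
        forall t, t \in s -> (mpdeg (t ^+ 2)%R <= D)%N /\ coef_bounded B t
      & forall i, (mpdeg (h i * P`_i)%R <= D)%N /\ coef_bounded B (h i)].

(* In the asymptotic notions below, d is fixed and P is a family of systems
   with P n a system in n variables. The bounds hold for all large n, with
   constants that may depend on d and on the families but not on n, nor on the
   polynomials, variables and accuracies quantified after them: O(d) is C * d,
   and 2^poly(..) is [2 `^ poly_bound c [:: ..]]. *)

(* Polynomial bit complexity is taken to mean poly(n) polynomials with
   coefficients bounded by 2^poly(n^d). *)
Definition admissible (R : realType) (d : nat)
    (P : forall n, seq {mpoly R[n]}) : Prop :=
  exists n0 C c : nat, forall n, (n0 <= n)%N ->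
    ((size (P n))%:R <= poly_bound c [:: n%:R : R]) /\
    forall p, p \in P n ->
      (mpdeg p <= C * d)%N /\
      coef_bounded (2 `^ poly_bound c [:: (n ^ d)%:R]) p.

Definition explicitly_archimedean (R : realType) (d : nat)
    (P : forall n, seq {mpoly R[n]}) : Prop :=
  exists n0 C c : nat, forall n, (n0 <= n)%N ->
    let B := 2 `^ poly_bound c [:: (n ^ d)%:R] in
    forall i : 'I_n, exists N : R,
      0 < N <= B /\ sos_proof (P n) (N%:MP - 'X_i ^+ 2) (C * d) B.

Definition sos_eps_complete (R : realType) (d : nat)
    (P : forall n, seq {mpoly R[n]}) (S : forall n, set ('I_n -> R)) : Prop :=
  exists n0 C c : nat, forall n, (n0 <= n)%N ->
    forall q : {mpoly R[n]}, (mpdeg q <= 2 * d)%N ->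
    (forall x, S n x -> q.@[x] = 0) ->
    forall eps : R, 0 < eps ->
      sos_proof (P n) (q + eps%:MP) (C * d)
        (2 `^ poly_bound c [:: (n ^ d)%:R; lg (coef_norm q); lg (1 / eps)]).

(* P <~_SoS P'; only meant for families with the same zero sets. *)
Definition sos_le (R : realType) (d : nat)
    (P P' : forall n, seq {mpoly R[n]}) : Prop :=
  exists n0 C c : nat, forall n, (n0 <= n)%N ->
    forall p, p \in P n -> forall eps : R, 0 < eps ->
      let B := 2 `^ poly_bound c [:: (n ^ d)%:R; lg (1 / eps)] in
      sos_proof (P' n) (p + eps%:MP) (C * d) B /\
      sos_proof (P' n) (- p + eps%:MP) (C * d) B.

(* Main.v *)
(* Start from a P1-proof of q + eps/2 and replace each product h p, p in P1, by
   a P2-proof of h p + (small constant). For a monomial X^m put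
   a, b = (X^m +- 1)/2, so that
     X^m p + delta (X^(2m) + 1)/2 = a^2 (p + delta) + b^2 (- p + delta),
   where p + delta and - p + delta have P2-proofs; then add delta/2 times a
   P2-proof of K - X^(2m) >= 0, which the Archimedean property yields by
   induction on m. Working monomial by monomial keeps coefficients under
   control, since multiplication by X^m, a or b does not increase the largest
   coefficient of a polynomial. The total error is delta times a quantity of
   size 2^poly, so delta = min(1, eps)/2^poly is small enough, and lg(1/delta)
   is still polynomial. *)
Require Import Defs.
From mathcomp Require Import all_boot all_order all_algebra.
From mathcomp Require Import mpoly ring lra zify.
From mathcomp Require Import classical_sets cardinality reals exp.

Set Implicit Arguments.
Unset Strict Implicit.
Unset Printing Implicit Defensive.

Import Order.TTheory GRing.Theory Num.Theory.

Local Open Scope ring_scope.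

(** * Degrees, supports and coefficient bounds of polynomials *)

Section Polynomials.
Variables (R : realType) (n : nat).
Implicit Types (p q a f : {mpoly R[n]}) (m : 'X_{1..n}).

Lemma mpdeg_leE p D : (mpdeg p <= D)%N = (msize p <= D.+1)%N.
Proof. by rewrite /mpdeg; case: (msize p). Qed.

Lemma mpdeg0 : mpdeg (0 : {mpoly R[n]}) = 0%N.
Proof. by rewrite /mpdeg msize0. Qed.

Lemma mpdegC (c : R) : mpdeg (c%:MP : {mpoly R[n]}) = 0%N.
Proof. by rewrite /mpdeg msizeC; case: (_ != _). Qed.

Lemma mpdegXm m : mpdeg ('X_[m] : {mpoly R[n]}) = mdeg m.
Proof. by rewrite /mpdeg msizeX. Qed.

Lemma mpdegD_le p q D :
  (mpdeg p <= D)%N -> (mpdeg q <= D)%N -> (mpdeg (p + q) <= D)%N.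
Proof.
rewrite !mpdeg_leE => hp hq; apply: leq_trans (msizeD_le p q) _.
by rewrite geq_max hp hq.
Qed.

(** Leading parts cannot cancel over a domain. Exact additivity later lets a degree bound on [h * p]
    pass to [h]. *)
Lemma mpdegM p q : p != 0 -> q != 0 -> mpdeg (p * q) = (mpdeg p + mpdeg q)%N.
Proof.
move=> p0 q0; rewrite /mpdeg msizeM //.
by move: p0 q0; rewrite -!msize_poly_eq0; case: (msize p); case: (msize q); lia.
Qed.

Lemma mpdegM_le p q D D' :
  (mpdeg p <= D)%N -> (mpdeg q <= D')%N -> (mpdeg (p * q) <= D + D')%N.
Proof.
have [->|p0] := eqVneq p 0; first by rewrite mul0r mpdeg0.
have [->|q0] := eqVneq q 0; first by rewrite mulr0 mpdeg0.
by rewrite mpdegM //; exact: leq_add.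
Qed.

Lemma coef_bounded_le p (B B' : R) :
  B <= B' -> coef_bounded B p -> coef_bounded B' p.
Proof. by move=> BB' Bp m; exact: le_trans BB'. Qed.

Lemma coef_bounded0 (B : R) : 0 <= B -> coef_bounded B (0 : {mpoly R[n]}).
Proof. by move=> B0 m; rewrite mcoeff0 normr0. Qed.

Lemma coef_boundedD p q (B B' : R) :
  coef_bounded B p -> coef_bounded B' q -> coef_bounded (B + B') (p + q).
Proof.
move=> Bp Bq m; rewrite mcoeffD; apply: le_trans (ler_normD _ _) _.
exact: lerD.
Qed.

Lemma coef_boundedCM p (B c : R) :
  coef_bounded B p -> coef_bounded (`|c| * B) (c%:MP * p).
Proof. by move=> Bp m; rewrite mcoeffCM normrM ler_wpM2l. Qed.

Lemma coef_boundedC (c : R) : coef_bounded `|c| (c%:MP : {mpoly R[n]}).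
Proof.
move=> m; rewrite mcoeffC normrM ler_piMr //.
by case: (m == _); rewrite ?normr1 ?normr0.
Qed.

(** These are the multipliers that may enter an SoS proof at a cost in degree only. A general
    product sums many coefficient products and would enlarge [B]. *)
Definition nonexpansive a :=
  forall f (B : R), coef_bounded B f -> coef_bounded B (a * f).

(** Multiplication by a monomial only shifts coefficients: the one at [k] is that of [f] at [k - m],
    or 0 if [m] does not divide [k]. *)
Lemma nonexpansiveX m : nonexpansive 'X_[m].
Proof.
move=> f B Bf k; rewrite mulrC.
have B0 : 0 <= B by exact: le_trans (Bf k).
have [mk|nmk] := boolP (m <= k)%MM.
  by rewrite -(submK mk) addmC mcoeffMX.
rewrite (_ : _@__ = 0) ?normr0 //; apply/eqP; rewrite mcoeff_eq0.
apply: contra nmk => /msuppM_le/allpairsP[[k1 k2] /= [_ + ->]].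
rewrite msuppX inE => /eqP ->; exact: lem_addl.
Qed.

Lemma nonexpansive_half_sum a b :
  nonexpansive a -> nonexpansive b -> nonexpansive ((2^-1 : R)%:MP * (a + b)).
Proof.
move=> na nb f B Bf.
have := coef_boundedCM (2^-1) (coef_boundedD (na _ _ Bf) (nb _ _ Bf)).
rewrite -mulrDl mulrA; apply: coef_bounded_le.
by rewrite ger0_norm ?invr_ge0 //; lra.
Qed.

Lemma nonexpansive1 : nonexpansive 1.
Proof. by move=> f B; rewrite mul1r. Qed.

Lemma nonexpansiveN1 : nonexpansive (- 1).
Proof. by move=> f B Bf m; rewrite mulN1r mcoeffN normrN. Qed.

(** Each exponent is at most [D], so the support injects into the functions from ['I_n] to
    ['I_D.+1]. This crude count is enough, being exponential in [n] for fixed [D]. *)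
Lemma size_msupp_le p D : (mpdeg p <= D)%N -> (size (msupp p) <= D.+1 ^ n)%N.
Proof.
rewrite mpdeg_leE => pD.
pose F m : {ffun 'I_n -> 'I_D.+1} := [ffun i => inord (m i)].
have -> : (D.+1 ^ n)%N = #|{: {ffun 'I_n -> 'I_D.+1}}|.
  by rewrite card_ffun !card_ord.
rewrite -(size_map F); set s := map F _.
have /card_uniqP <- : uniq s; last exact: max_card.
rewrite map_inj_in_uniq ?msupp_uniq // => m1 m2 m1p m2p /ffunP eF.
have small m i : m \in msupp p -> (m i < D.+1)%N.
  move=> /msize_mdeg_lt mp; apply: leq_ltn_trans _ (leq_trans mp pD).
  by rewrite mdegE (bigD1 i) //= leq_addr.
apply/mnmP => i; have := eF i; rewrite !ffunE => /(congr1 val) /=.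
by rewrite !inordK ?small.
Qed.

Lemma mdeg_le_mpdeg p D m : (mpdeg p <= D)%N -> m \in msupp p -> (mdeg m <= D)%N.
Proof.
by rewrite mpdeg_leE => pD /msize_mdeg_lt mp; exact: leq_trans mp pD.
Qed.

End Polynomials.

(** * Operations on SoS proofs over a fixed system *)

Section SosProofs.
Variables (R : realType) (n : nat) (P : seq {mpoly R[n]}).
Implicit Types (p q a : {mpoly R[n]}) (D : nat) (B : R).

Lemma sos_proof_le q D D' B B' : (D <= D')%N -> B <= B' ->
  sos_proof P q D B -> sos_proof P q D' B'.
Proof.
move=> DD' BB' [s [h [-> ts hs]]]; exists s, h; split => //.
  move=> t /ts[tD tB]; split; first exact: leq_trans DD'.
  exact: coef_bounded_le tB.
move=> i; have [hD hB] := hs i; split; first exact: leq_trans DD'.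
exact: coef_bounded_le hB.
Qed.

Lemma sos_proof_squares (s : seq {mpoly R[n]}) D B : 0 <= B ->
  (forall t, t \in s -> (mpdeg (t ^+ 2)%R <= D)%N /\ coef_bounded B t) ->
  sos_proof P (\sum_(t <- s) t ^+ 2) D B.
Proof.
move=> B0 ts; exists s, (fun=> 0); split => //.
  by rewrite [X in _ + X]big1 ?addr0 // => i _; rewrite mul0r.
by move=> i; rewrite mul0r mpdeg0; split=> //; exact: coef_bounded0.
Qed.

(* The number of squares is not limited, so that a large constant is a sum of
   squares of constants in [0, 1]. *)
Lemma sos_proofC (c : R) D B : 0 <= c -> 1 <= B -> sos_proof P c%:MP D B.
Proof.
move=> c0 B1; pose N := (Num.truncn c).+1.
have cN : c < N%:R by exact: truncnS_gt.
have N0 : 0 < N%:R :> R by rewrite ltr0n.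
have cN0 : 0 <= c / N%:R by rewrite divr_ge0 // ltW.
have -> : c%:MP =
    \sum_(t <- nseq N ((Num.sqrt (c / N%:R))%:MP : {mpoly R[n]})) t ^+ 2.
  rewrite big_nseq; set u := _ ^+ 2.
  have -> : iter N (+%R u) 0 = u *+ N by rewrite iter_addr addr0.
  rewrite /u -rmorphXn /= sqr_sqrtr // -mpolyCMn; congr _%:MP.
  by rewrite -[RHS]mulr_natr divfK // gt_eqF.
apply: sos_proof_squares => [|t]; first exact: le_trans ler01 B1.
move=> /nseqP[-> _]; rewrite -rmorphXn /= mpdegC; split=> //.
apply: (coef_bounded_le _ (@coef_boundedC R n _)); apply: le_trans B1.
rewrite ger0_norm ?sqrtr_ge0 // -[leRHS]sqrtr1 ler_wsqrtr //.
by rewrite ler_pdivrMr // mul1r ltW.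
Qed.

Lemma sos_proofD q1 q2 D B1 B2 : 0 <= B1 -> 0 <= B2 ->
  sos_proof P q1 D B1 -> sos_proof P q2 D B2 -> sos_proof P (q1 + q2) D (B1 + B2).
Proof.
move=> B10 B20 [s1 [h1 [-> ts1 hs1]]] [s2 [h2 [-> ts2 hs2]]].
exists (s1 ++ s2), (fun i => h1 i + h2 i); split.
- rewrite big_cat /= addrACA; congr (_ + _); rewrite -big_split /=.
  by apply: eq_bigr => i _; rewrite mulrDl.
- move=> t; rewrite mem_cat => /orP[/ts1|/ts2] [tD tB]; split => //.
    by apply: coef_bounded_le tB; rewrite lerDl.
  by apply: coef_bounded_le tB; rewrite lerDr.
- move=> i; have [hD1 hB1] := hs1 i; have [hD2 hB2] := hs2 i; split.
    by rewrite mulrDl mpdegD_le.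
  exact: coef_boundedD.
Qed.

Lemma sos_proof_sum (I : eqType) (r : seq I) (q : I -> {mpoly R[n]}) D B :
  0 <= B -> (forall i, i \in r -> sos_proof P (q i) D B) ->
  sos_proof P (\sum_(i <- r) q i) D ((size r)%:R * B).
Proof.
move=> B0; elim: r => [|i r IH] qs.
  rewrite big_nil mul0r; have := @sos_proof_squares [::] D 0 (lexx _).
  by rewrite big_nil; apply.
rewrite big_cons /= -nat1r mulrDl mul1r.
apply: sos_proofD => //; first exact: mulr_ge0.
  by apply: qs; rewrite mem_head.
by apply: IH => j jr; apply: qs; rewrite inE jr orbT.
Qed.

(** The squared polynomials scale by the square root of [c] and the multipliers by [c]; the factor
    [1 + c] dominates both. *)
Lemma sos_proofZ (c : R) q D B : 0 <= B -> 0 <= c -> sos_proof P q D B ->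
  sos_proof P (c%:MP * q) D ((1 + c) * B).
Proof.
move=> B0 c0 [s [h [-> ts hs]]].
exists [seq (Num.sqrt c)%:MP * t | t <- s], (fun i => c%:MP * h i); split.
- rewrite mulrDr big_map !mulr_sumr; congr (_ + _); apply: eq_bigr => i _.
    by rewrite exprMn -rmorphXn /= sqr_sqrtr.
  by rewrite mulrA.
- move=> _ /mapP[t /ts[tD tB] ->]; split.
    rewrite exprMn -rmorphXn /= -[D]add0n.
    by apply: mpdegM_le => //; rewrite mpdegC.
  apply: coef_bounded_le (coef_boundedCM _ tB); apply: ler_wpM2r => //.
  rewrite ger0_norm ?sqrtr_ge0 //.
  have := sqr_sqrtr c0; have := sqrtr_ge0 c; nra.
- move=> i; have [hD hB] := hs i; split.
    by rewrite -mulrA -[D]add0n; apply: mpdegM_le => //; rewrite mpdegC.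
  apply: coef_bounded_le (coef_boundedCM _ hB); apply: ler_wpM2r => //.
  by rewrite ger0_norm // lerDr.
Qed.

Lemma sos_proof_sqrM a q D D' B : nonexpansive a -> (mpdeg a <= D')%N ->
  sos_proof P q D B -> sos_proof P (a ^+ 2 * q) (D + D' + D') B.
Proof.
move=> na aD' [s [h [-> ts hs]]].
have a2D' : (mpdeg (a ^+ 2)%R <= D' + D')%N by rewrite expr2 mpdegM_le.
exists [seq a * t | t <- s], (fun i => a ^+ 2 * h i); split.
- rewrite mulrDr big_map !mulr_sumr; congr (_ + _); apply: eq_bigr => i _.
    by rewrite exprMn.
  by rewrite mulrA.
- move=> _ /mapP[t /ts[tD tB] ->]; split; last exact: na.
  by rewrite exprMn -addnA addnC; exact: mpdegM_le.
- move=> i; have [hD hB] := hs i; split.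
    by rewrite -mulrA -addnA addnC; apply: mpdegM_le.
  by rewrite expr2 -mulrA; exact: (na _ _ (na _ _ hB)).
Qed.

(** Induction on [k], stripping one variable [x_i] from [m = m' + U_(i)]: A^(k+1) - X^(2m) = A (A^k
    - X^(2m')) + X^(2m') (A - x_i^2). With [V] the previous bound, a step costs (1 + A) V + U, at
    most (2 + A) V because U <= V. *)
Lemma sos_proof_monomial (A U : R) D m k : 1 <= A -> 1 <= U ->
  (forall i, sos_proof P (A%:MP - 'X_i ^+ 2) D U) -> (mdeg m <= k)%N ->
  sos_proof P ((A ^+ k)%:MP - 'X_[m] ^+ 2) (D + k + k) (U * (2 + A) ^+ k).
Proof.
move=> A1 U1 arch; elim: k m => [|k IH] m mk.
  move: mk; rewrite leqn0 mdeg_eq0 => /eqP->.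
  rewrite mpolyX0 expr1n expr0 subrr -mpolyC0; apply: sos_proofC => //.
  by rewrite expr0 mulr1.
have A20 : 1 <= 2 + A by lra.
have A2k : 1 <= (2 + A) ^+ k by rewrite exprn_ege1.
(* As [k] only bounds the degree, [m] may have no variable left to strip; the claim is then about a
   nonnegative constant. *)
have [m0|] := eqVneq m 0%MM.
  rewrite m0 mpolyX0 expr1n -mpolyC1 -mpolyCB; apply: sos_proofC.
    by rewrite subr_ge0 exprn_ege1.
  by apply: mulr_ege1 => //; rewrite exprn_ege1.
move=> m0; have [i mi] : exists i, (0 < m i)%N.
  apply/existsP; apply: contraNT m0; rewrite negb_exists => /forallP m0.
  by apply/eqP/mnmP => i; rewrite mnm0E; have := m0 i; case: (m i).
have Um : (U_(i) <= m)%MM by apply/mnm_lepP => j; rewrite mnm1E; case: eqP => [<-|].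
pose m' := (m - U_(i))%MM; have mE : m = (m' + U_(i))%MM by rewrite submK.
have m'k : (mdeg m' <= k)%N by move: mk; rewrite mE mdegD mdeg1 addn1.
have -> : (A ^+ k.+1)%:MP - 'X_[m] ^+ 2 =
    A%:MP * ((A ^+ k)%:MP - 'X_[m'] ^+ 2) +
    'X_[m'] ^+ 2 * (A%:MP - 'X_i ^+ 2).
  by rewrite mE mpolyXD exprS mpolyCM; ring.
apply: (@sos_proof_le _ (D + k.+1 + k.+1) _
  ((1 + A) * (U * (2 + A) ^+ k) + U)) => //.
  rewrite exprS -subr_ge0 [leRHS](_ : _ = U * ((2 + A) ^+ k - 1)); last by ring.
  by rewrite mulr_ge0 ?subr_ge0 //; lra.
have V0 : 0 <= U * (2 + A) ^+ k by rewrite mulr_ge0 ?exprn_ge0 //; lra.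
apply: sos_proofD; [by rewrite mulr_ge0 //; lra|lra| |].
  apply: sos_proof_le (lexx _) (sos_proofZ _ _ (IH _ m'k)); [lia|done|lra].
have := sos_proof_sqrM (@nonexpansiveX _ _ m') _ (arch i).
rewrite mpdegXm => /(_ _ m'k); apply: sos_proof_le => //; lia.
Qed.

(* [a, b = (X^m +- 1) / 2] satisfy [a^2 - b^2 = X^m] and
   [a^2 + b^2 = (X^(2 m) + 1) / 2]. *)
Lemma sos_proof_monomialM (A U W delta : R) D m p : 1 <= A -> 1 <= U ->
  0 <= W -> 0 <= delta -> delta <= 1 ->
  (forall i, sos_proof P (A%:MP - 'X_i ^+ 2) D U) -> (mdeg m <= D)%N ->
  sos_proof P (p + delta%:MP) D W -> sos_proof P (- p + delta%:MP) D W ->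
  sos_proof P ('X_[m] * p + (delta * ((A ^+ D + 1) / 2))%:MP) (D + D + D)
    (2 * W + 2 * (U * (2 + A) ^+ D)).
Proof.
move=> A1 U1 W0 d0 d1 arch mD Pp Pn.
set V := U * _; have V0 : 0 <= V by rewrite mulr_ge0 ?exprn_ge0 //; lra.
pose h : {mpoly R[n]} := (2^-1)%:MP.
pose a := h * ('X_[m] + 1); pose b := h * ('X_[m] + (- 1)).
have h2 : h * 2 = 1.
  have -> : 2 = (2 : R)%:MP :> {mpoly R[n]} by rewrite rmorph_nat.
  by rewrite -mpolyCM mulVf ?mpolyC1 // pnatr_eq0.
have na : nonexpansive a.
  by apply: nonexpansive_half_sum; [exact: nonexpansiveX|exact: nonexpansive1].
have nb : nonexpansive b.
  by apply: nonexpansive_half_sum; [exact: nonexpansiveX|exact: nonexpansiveN1].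
have deg1 c : (mpdeg (h * ('X_[m] + c%:MP)) <= D)%N.
  rewrite -[D]add0n mpdegM_le ?mpdegC // mpdegD_le ?mpdegC ?mpdegXm //.
have aD : (mpdeg a <= D)%N by have := deg1 1; rewrite mpolyC1.
have bD : (mpdeg b <= D)%N by have := deg1 (-1); rewrite mpolyCN mpolyC1.
have -> : 'X_[m] * p + (delta * ((A ^+ D + 1) / 2))%:MP =
    a ^+ 2 * (p + delta%:MP) + b ^+ 2 * (- p + delta%:MP) +
    (delta * 2^-1)%:MP * ((A ^+ D)%:MP - 'X_[m] ^+ 2).
  rewrite !mpolyCM mpolyCD mpolyC1 -/h /a /b; set K := (A ^+ D)%:MP.
  set x := 'X_[m]; set e := delta%:MP.
  (* [h] stands for one half; the factors [h * 2] are exposed so that [h2] can turn them into 1 on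
     both sides. *)
  transitivity ((h * 2) * (h * 2) * (x * p) + e * (K + 1) * h).
    by rewrite h2; ring.
  transitivity ((h * 2) * (h * 2) * (x * p) + (h * 2) * h * (x ^+ 2 + 1) * e +
    e * h * (K - x ^+ 2)); last by ring.
  by rewrite h2; ring.
apply: (@sos_proof_le _ (D + D + D) _ ((W + W) + (1 + delta * 2^-1) * V)) => //.
  nra.
apply: sos_proofD; [lra|nra| |].
  by apply: sos_proofD => //; apply: sos_proof_sqrM.
by apply: sos_proofZ => //; [lra|exact: sos_proof_monomial].
Qed.

(** Expand [h] into at most [M] monomials and treat each term separately, absorbing the sign of its
    coefficient into [p]. The final [+ 1] in the bound pays for a constant that rounds the total
    error up to a value independent of [h]. *)
Lemma sos_proof_polyM (A U W M delta B : R) D h p : 1 <= A -> 1 <= U ->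
  0 <= W -> 0 <= delta -> delta <= 1 -> 0 <= B -> (D.+1 ^ n)%:R <= M ->
  (forall i, sos_proof P (A%:MP - 'X_i ^+ 2) D U) ->
  (mpdeg (h * p)%R <= D)%N -> coef_bounded B h ->
  sos_proof P (p + delta%:MP) D W -> sos_proof P (- p + delta%:MP) D W ->
  sos_proof P (h * p + (delta * (M * B * (A ^+ D + 1)) / 2)%:MP) (D + D + D)
    (M * ((1 + B) * (2 * W + 2 * (U * (2 + A) ^+ D))) + 1).
Proof.
move=> A1 U1 W0 d0 d1 B0 DM arch hpD hB Pp Pn.
set V := U * _; have V0 : 0 <= V by rewrite mulr_ge0 ?exprn_ge0 //; lra.
set K := A ^+ D; have K1 : 1 <= K by rewrite exprn_ege1.
set G := (X in X%:MP).
have M0 : 0 <= M by apply: le_trans DM.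
have BWV0 : 0 <= (1 + B) * (2 * W + 2 * V) by rewrite mulr_ge0 //; lra.
have MBWV0 := mulr_ge0 M0 BWV0.
(* If [p] is 0, the degree of [h * p] does not control that of [h]; the claim is then about a
   constant. *)
have [p0|p0] := eqVneq p 0.
  rewrite p0 mulr0 add0r; apply: sos_proofC; last by rewrite lerDr.
  by rewrite divr_ge0 // !mulr_ge0 //; lra.
have hD : (mpdeg h <= D)%N.
  have [->|h0] := eqVneq h 0; first by rewrite mpdeg0.
  by move: hpD; rewrite mpdegM //; apply: leq_trans; exact: leq_addr.
have sM : (size (msupp h))%:R <= M.
  by apply: le_trans DM; rewrite ler_nat size_msupp_le.
pose g := delta * ((K + 1) / 2).
have g0 : 0 <= g by rewrite mulr_ge0 // divr_ge0 //; lra.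
have gG : \sum_(m <- msupp h) `|h@_m| * g <= G.
  apply: (@le_trans _ _ (\sum_(m <- msupp h) B * g)).
    by apply: ler_sum => m _; rewrite ler_wpM2r.
  rewrite big_const_seq count_predT iter_addr addr0 -[leLHS]mulr_natl.
  have -> : G = M * (B * g) by rewrite /G /g; field.
  by rewrite ler_wpM2r // mulr_ge0.
(* Each monomial receives its own error [g] times the absolute value of its coefficient; what is
   left of [G] is a nonnegative constant. *)
rewrite -[G](subrKC (\sum_(m <- msupp h) `|h@_m| * g)) mpolyCD addrA.
apply: sos_proofD => //; last by apply: sos_proofC; rewrite ?subr_ge0.
rewrite [X in X * p]mpolyE mulr_suml raddf_sum -big_split /=.
apply: (@sos_proof_le _ (D + D + D) _
  ((size (msupp h))%:R * ((1 + B) * (2 * W + 2 * V)))) => //.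
  by rewrite ler_wpM2r.
apply: sos_proof_sum => // m mh.
have mD := mdeg_le_mpdeg hD mh.
apply: (@sos_proof_le _ (D + D + D) _ ((1 + `|h@_m|) * (2 * W + 2 * V))) => //.
  by rewrite ler_wpM2r ?lerD //; lra.
rewrite mpolyCM -mul_mpolyC.
have [c0|c0] := leP 0 h@_m.
  rewrite ger0_norm // -mulrA -mulrDr.
  apply: sos_proofZ => //; first lra.
  exact: sos_proof_monomialM.
rewrite ltr0_norm //.
(* For a negative coefficient, the roles of the proofs for [p] and [- p] are exchanged. *)
have -> : (h@_m)%:MP * 'X_[m] * p + (- h@_m)%:MP * g%:MP =
   (- h@_m)%:MP * ('X_[m] * (- p) + g%:MP) by rewrite mpolyCN; ring.
apply: sos_proofZ => //; [lra|lra|].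
by apply: sos_proof_monomialM => //; rewrite opprK.
Qed.

Lemma sos_proof_transfer (P' : seq {mpoly R[n]}) (A U W M Z delta eps B : R) D q :
  1 <= A -> 1 <= U -> 0 <= W -> 0 <= delta -> delta <= 1 -> 0 <= B ->
  (D.+1 ^ n)%:R <= M -> (size P')%:R <= Z ->
  (forall i, sos_proof P (A%:MP - 'X_i ^+ 2) D U) ->
  (forall p, p \in P' -> sos_proof P (p + delta%:MP) D W /\
     sos_proof P (- p + delta%:MP) D W) ->
  delta * (Z * (M * B * (A ^+ D + 1))) / 2 <= eps ->
  sos_proof P' q D B ->
  sos_proof P (q + eps%:MP) (D + D + D)
    (B + Z * (M * ((1 + B) * (2 * W + 2 * (U * (2 + A) ^+ D))) + 1) + 1).
Proof.
move=> A1 U1 W0 d0 d1 B0 DM sZ arch P'P epsE [s [h [-> ts hs]]].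
have M0 : 0 <= M by apply: le_trans DM.
have Z0 : 0 <= Z by apply: le_trans sZ.
have A0 : 0 <= A by lra.
set V := M * _ + 1.
have V0 : 0 <= V.
  have : 0 <= U * (2 + A) ^+ D by rewrite mulr_ge0 ?exprn_ge0 //; lra.
  by move=> ?; rewrite addr_ge0 // mulr_ge0 // mulr_ge0 //; lra.
pose G := delta * (M * B * (A ^+ D + 1)) / 2.
have G0 : 0 <= G by rewrite divr_ge0 // !mulr_ge0 // addr_ge0 // exprn_ge0.
have -> : \sum_(t <- s) t ^+ 2 + \sum_(i < size P') h i * P'`_i + eps%:MP =
    \sum_(t <- s) t ^+ 2 + \sum_(i < size P') (h i * P'`_i + G%:MP) +
    (eps - (size P')%:R * G)%:MP.
  rewrite big_split /= sumr_const card_ord mpolyCB -mpolyCMn mulr_natl.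
  by rewrite -!addrA [X in _ = _ + (_ + X)]subrKC.
have sG : (size P')%:R * G <= eps.
  apply: le_trans epsE; rewrite [leRHS](_ : _ = Z * G); last by rewrite /G; ring.
  by rewrite ler_wpM2r.
have ZV0 := mulr_ge0 Z0 V0.
apply: sos_proofD => //; [lra| |by apply: sos_proofC; rewrite ?subr_ge0].
have D3 : (D <= D + D + D)%N by rewrite -addnA leq_addr.
apply: sos_proofD => //.
  apply: (sos_proof_le D3 (lexx B)); exact: sos_proof_squares.
apply: (@sos_proof_le _ _ _ ((size (index_enum 'I_(size P')))%:R * V) _ (leqnn _)).
  have -> : size (index_enum 'I_(size P')) = size P'.
    by rewrite -[RHS]card_ord cardT enumT.
  by rewrite ler_wpM2r.
apply: sos_proof_sum => // i _.
have [hD hB] := hs i; have [Pp Pn] := P'P P'`_i (mem_nth _ (ltn_ord i)).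
exact: sos_proof_polyM.
Qed.

End SosProofs.

(** * Polynomial and 2^poly growth, and the truncated logarithm *)

Section Growth.
Variable R : realType.
Implicit Types (f g : R -> R) (x y : R).

(** One variable suffices, since [poly_bound] depends on its arguments only through one plus their
    sum; hence also [1 <= x]. Nonnegativity gives closure under products. *)
Definition polynomially_bounded g :=
  exists k : nat, forall x, 1 <= x -> 0 <= g x <= k%:R * x ^+ k.

Definition exp_poly_bounded f :=
  exists2 g, polynomially_bounded g & forall x, 1 <= x -> 0 <= f x <= 2 `^ g x.

Lemma polynomially_bounded_nat (c : nat) : polynomially_bounded (fun=> c%:R).
Proof. by exists c => x x1; rewrite ler0n ler_peMr // exprn_ege1. Qed.

Lemma polynomially_bounded_id : polynomially_bounded id.
Proof. by exists 1%N => x x1; rewrite mul1r expr1 lexx andbT; lra. Qed.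

Lemma polynomially_boundedD g1 g2 : polynomially_bounded g1 ->
  polynomially_bounded g2 -> polynomially_bounded (fun x => g1 x + g2 x).
Proof.
move=> [k kP] [l lP]; exists (k + l)%N => x x1.
have /andP[g10 g1k] := kP x x1; have /andP[g20 g2l] := lP x x1.
rewrite addr_ge0 //= natrD mulrDl; apply: lerD.
  by apply: le_trans g1k _; rewrite ler_wpM2l // ler_weXn2l // leq_addr.
by apply: le_trans g2l _; rewrite ler_wpM2l // ler_weXn2l // leq_addl.
Qed.

Lemma polynomially_boundedM g1 g2 : polynomially_bounded g1 ->
  polynomially_bounded g2 -> polynomially_bounded (fun x => g1 x * g2 x).
Proof.
move=> [k kP] [l lP]; exists (k * l + (k + l))%N => x x1.
have /andP[g10 g1k] := kP x x1; have /andP[g20 g2l] := lP x x1.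
rewrite mulr_ge0 //=; apply: le_trans (ler_pM g10 g20 g1k g2l) _.
rewrite mulrACA -natrM -exprD; apply: ler_pM => //.
- by rewrite exprn_ge0 //; lra.
- by rewrite ler_nat leq_addr.
- by rewrite ler_weXn2l // leq_addl.
Qed.

Lemma polynomially_boundedX g (c : nat) : polynomially_bounded g ->
  polynomially_bounded (fun x => g x ^+ c).
Proof.
move=> gP; elim: c => [|c IH].
  by have [k kP] := polynomially_bounded_nat 1; exists k => x /kP; rewrite expr0.
have [k kP] := polynomially_boundedM gP IH.
by exists k => x /kP; rewrite exprS.
Qed.

Lemma exp_poly_bounded_pow g : polynomially_bounded g ->
  exp_poly_bounded (fun x => 2 `^ g x).
Proof. by move=> gP; exists g => // x _; rewrite powR_ge0 lexx. Qed.

(** For y >= 0 with integer part k, y < k + 1 <= 2^k <= 2^y. *)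
Lemma exp_poly_bounded_poly g : polynomially_bounded g -> exp_poly_bounded g.
Proof.
move=> gP; exists g => // x x1; have [k /(_ x x1)/andP[g0 _]] := gP.
rewrite g0 /=; apply: (@le_trans _ _ (2 `^ (Num.truncn (g x))%:R)).
  rewrite powR_mulrn //; apply: le_trans (ltW (truncnS_gt _)) _.
  by rewrite -natrX ler_nat ltn_expl.
by apply: ler_powR; [lra|rewrite truncn_le].
Qed.

Lemma exp_poly_bounded_nat (c : nat) : exp_poly_bounded (fun=> c%:R).
Proof. exact/exp_poly_bounded_poly/polynomially_bounded_nat. Qed.

Lemma exp_poly_boundedM f1 f2 : exp_poly_bounded f1 ->
  exp_poly_bounded f2 -> exp_poly_bounded (fun x => f1 x * f2 x).
Proof.
move=> [g1 g1P f1P] [g2 g2P f2P]; exists (fun x => g1 x + g2 x).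
  exact: polynomially_boundedD.
move=> x x1; have /andP[f10 f1g] := f1P x x1; have /andP[f20 f2g] := f2P x x1.
rewrite mulr_ge0 //= powRD ?pnatr_eq0 ?implybT //; exact: ler_pM.
Qed.

(** One extra bit in the exponent accounts for the sum of two terms. *)
Lemma exp_poly_boundedD f1 f2 : exp_poly_bounded f1 ->
  exp_poly_bounded f2 -> exp_poly_bounded (fun x => f1 x + f2 x).
Proof.
move=> [g1 g1P f1P] [g2 g2P f2P]; exists (fun x => g1 x + g2 x + 1%:R).
  apply: polynomially_boundedD (polynomially_bounded_nat 1).
  exact: polynomially_boundedD.
move=> x x1; have /andP[f10 f1g] := f1P x x1; have /andP[f20 f2g] := f2P x x1.
have [k1 /(_ x x1)/andP[g10 _]] := g1P; have [k2 /(_ x x1)/andP[g20 _]] := g2P.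
rewrite addr_ge0 //= powRD ?pnatr_eq0 ?implybT // powRr1 // mulr_natr mulr2n.
apply: lerD; [apply: le_trans f1g _|apply: le_trans f2g _];
  by apply: ler_powR; lra.
Qed.

Lemma exp_poly_boundedX f (c : nat) : exp_poly_bounded f ->
  exp_poly_bounded (fun x => f x ^+ c).
Proof.
move=> fP; elim: c => [|c IH].
  by have [g gP kP] := exp_poly_bounded_nat 1; exists g => // x /kP; rewrite expr0.
have [g gP kP] := exp_poly_boundedM fP IH.
by exists g => // x /kP; rewrite exprS.
Qed.

Lemma exp_poly_boundedP f : exp_poly_bounded f ->
  exists k : nat, forall x, 1 <= x -> f x <= 2 `^ (k%:R * x ^+ k).
Proof.
move=> [g [k kP] fP]; exists k => x x1.
have /andP[_ fg] := fP x x1; have /andP[_ gk] := kP x x1.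
by apply: le_trans fg _; apply: ler_powR => //; lra.
Qed.

Lemma lg_ge0 x : 0 <= lg x.
Proof. by rewrite /lg le_max lexx. Qed.

Lemma ln2_gt0 : 0 < ln 2 :> R.
Proof. by rewrite ln_gt0 //; lra. Qed.

Lemma lgM x y : 0 < x -> 0 < y -> lg (x * y) <= lg x + lg y.
Proof.
move=> x0 y0; rewrite {1}/lg ge_max addr_ge0 ?lg_ge0 //=.
by rewrite lnM // mulrDl lerD // /lg le_max lexx orbT.
Qed.

Lemma lg_powR2 x : 0 <= x -> lg (2 `^ x) = x.
Proof.
move=> x0; rewrite /lg ln_powR mulfK; first by apply/max_idPr.
by rewrite gt_eqF // ln2_gt0.
Qed.

Lemma lg_inv_min1 x : 0 < x -> lg (1 / Num.min 1 x) <= lg (1 / x).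
Proof.
move=> x0; have [x1|x1] := leP 1 x; last by [].
by rewrite divr1 /lg ln1 mul0r maxxx lg_ge0.
Qed.

Lemma poly_bound_le (c : nat) (xs : seq R) y :
  0 <= \sum_(x <- xs) x -> 1 + \sum_(x <- xs) x <= y ->
  poly_bound c xs <= c%:R * y ^+ c.
Proof.
move=> xs0 xsy; rewrite /poly_bound ler_wpM2l // lerXn2r // nnegrE; lra.
Qed.

End Growth.

(** * Positivity of [d], and the choice of parameters for families of systems *)

Lemma explicitly_archimedean_degree_gt0 (R : realType) (d : nat)
    (P : forall n, seq {mpoly R[n]}) : explicitly_archimedean d P -> (0 < d)%N.
Proof.
(* In degree 0 nothing cancels the term -x_0^2 of N - x_0^2. *)
move=> [n0 [C [c arch]]]; rewrite lt0n; apply/negP => /eqP d0.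
have [N [_ [s [h [e ts hs]]]]] := arch n0.+1 (leqnSn n0) ord0.
have : (mpdeg (N%:MP - 'X_ord0 ^+ 2 : {mpoly R[n0.+1]})%R <= 0)%N.
  rewrite e; move: ts hs; rewrite d0 muln0 => ts hs; apply: mpdegD_le.
    rewrite big_seq; elim/big_ind: _ => [|p q|t /ts[]//].
      by rewrite mpdeg0.
    exact: mpdegD_le.
  elim/big_ind: _ => [|p q|i _]; first by rewrite mpdeg0.
    exact: mpdegD_le.
  by have [] := hs i.
rewrite mpdeg_leE => f1.
pose m2 := (U_(ord0) *+ 2)%MM : 'X_{1..n0.+1}.
have m2d : mdeg m2 = 2%N by rewrite mdegMn mdeg1.
have : m2 \notin msupp (N%:MP - 'X_ord0 ^+ 2).
  by apply: msize_mdeg_ge; rewrite m2d; exact: leq_trans f1 _.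
rewrite -mcoeff_eq0 mcoeffB mcoeffC mcoeffXn eqxx -mdeg_eq0 m2d mulr0 sub0r.
by rewrite oppr_eq0 oner_eq0.
Qed.

Theorem mainTheorem6 (R : realType) (d : nat)
    (P1 P2 : forall n, seq {mpoly R[n]}) (S : forall n, set ('I_n -> R))
    (adm1 : admissible d P1) (adm2 : admissible d P2)
    (finS : forall n, finite_set (S n))
    (zeros1 : forall n, zeros (P1 n) = S n)
    (zeros2 : forall n, zeros (P2 n) = S n)
    (complete1 : sos_eps_complete d P1 S)
    (archimedean2 : explicitly_archimedean d P2)
    (le12 : sos_le d P1 P2) :
  sos_eps_complete d P2 S.
Proof.
have d0 := explicitly_archimedean_degree_gt0 archimedean2.
move: adm1 complete1 archimedean2 le12.
move=> [ns [Cs [cs adm]]] [n1 [C1 [c1 cpl]]].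
move=> [na [Ca [ca arch]]] [nl [Cl [cl le12]]].
have [C [C1C CaC ClC]] : exists C, [/\ (C1 <= C)%N, (Ca <= C)%N & (Cl <= C)%N].
  by exists (C1 + Ca + Cl)%N; split; lia.
pose D := (C * d)%N.
(* With [x] later equal to 1 + n^d + lg of the norm of [q] + lg(1/eps), these bound the squares of
   the variables ([A]), the coefficients of the [P1]-proof ([B]), the number of monomials ([M]) and
   of equations in [P1] ([Z]). [G] is twice the total error per unit of [delta]. In [B], [x + x]
   leaves room for lg(2/eps). *)
pose A (x : R) := 2 `^ (ca%:R * x ^+ ca).
pose B (x : R) := 2 `^ (c1%:R * (x + x) ^+ c1).
pose M (x : R) := 2 `^ (D%:R * x).
pose Z (x : R) := cs%:R * (x + x) ^+ cs.
pose G x := Z x * (M x * B x * (A x ^+ D + 1)).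
have pid := @polynomially_bounded_id R.
have pnat := @polynomially_bounded_nat R.
have bA : exp_poly_bounded A.
  by apply/exp_poly_bounded_pow/polynomially_boundedM/polynomially_boundedX.
have bB : exp_poly_bounded B.
  apply/exp_poly_bounded_pow/polynomially_boundedM => //.
  exact/polynomially_boundedX/polynomially_boundedD.
have bM : exp_poly_bounded M.
  exact/exp_poly_bounded_pow/polynomially_boundedM.
have bZ : exp_poly_bounded Z.
  apply/exp_poly_bounded_poly/polynomially_boundedM => //.
  exact/polynomially_boundedX/polynomially_boundedD.
have b1 : exp_poly_bounded (fun=> 1 : R) := exp_poly_bounded_nat R 1.
have b2 : exp_poly_bounded (fun=> 2 : R) := exp_poly_bounded_nat R 2.
have bG : exp_poly_bounded G.
  apply: exp_poly_boundedM => //; apply: exp_poly_boundedM.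
    exact: exp_poly_boundedM.
  by apply: exp_poly_boundedD => //; exact: exp_poly_boundedX.
(* [t] fixes the scale 2^(-t) of [delta]; [W] then bounds the proofs at accuracy [delta], for which
   lg(1/delta) <= t x + x. There is no circularity, as [G] does not contain [W]. *)
have [k Gk] := exp_poly_boundedP bG.
pose t (x : R) := k%:R * x ^+ k.
pose W x := 2 `^ (cl%:R * (x + (t x + x)) ^+ cl).
have pt : polynomially_bounded t.
  by apply: polynomially_boundedM => //; exact: polynomially_boundedX.
have bW : exp_poly_bounded W.
  apply/exp_poly_bounded_pow/polynomially_boundedM => //.
  by apply/polynomially_boundedX/polynomially_boundedD/polynomially_boundedD.
(* This is the coefficient bound of [sos_proof_transfer] with [U] taken as [A x + 1]. *)
pose F x := B x + Z x * (M x * ((1 + B x) * (2 * W x +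
  2 * ((A x + 1) * (2 + A x) ^+ D))) + 1) + 1.
have bF : exp_poly_bounded F.
  rewrite /F; repeat (first [exact: bA | exact: bB | exact: bM | exact: bZ |
    exact: bW | exact: b1 | exact: b2 | apply: exp_poly_boundedD |
    apply: exp_poly_boundedM | apply: exp_poly_boundedX ]).
have [c Fc] := exp_poly_boundedP bF.
exists (maxn 1 (maxn (maxn ns n1) (maxn na nl))), (C + C + C)%N, c => n.
rewrite !geq_max => /and3P[n_gt0 /andP[ns_n n1_n] /andP[na_n nl_n]].
move=> q qd qS eps eps0.
have {adm} [sP1 _] := adm n ns_n.
have {}cpl := cpl n n1_n q qd qS (eps / 2) (divr_gt0 eps0 (ltr0Sn _ _)).
have {}arch := arch n na_n.
have {}le12 := le12 n nl_n.
set L := lg (coef_norm q) in cpl *; set e := lg (1 / eps).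
pose E : R := (n ^ d)%:R.
pose x : R := 1 + \sum_(y <- [:: E; L; e]) y.
have xE : x = 1 + (E + (L + e)) by rewrite /x !big_cons big_nil addr0.
have E0 : 0 <= E by rewrite ler0n.
have L0 : 0 <= L by exact: lg_ge0.
have e0 : 0 <= e by exact: lg_ge0.
have x1 : 1 <= x by lra.
(* Positivity of [d] enters here: bounds in [n] become bounds in n^d. *)
have nE : n%:R <= E.
  by rewrite ler_nat -{1}[n]expn1 leq_pexp2l.
have t0 : 0 <= t x by rewrite mulr_ge0 // exprn_ge0 //; lra.
pose T := 2 `^ t x : R.
have T1 : 1 <= T by rewrite -(powRr0 2) ler_powR //; lra.
(* Truncating eps at 1 keeps delta bounded when eps is large, where
   lg (1 / eps) = 0 gives no control over eps. *)
pose mu := Num.min 1 eps.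
have mu0 : 0 < mu by rewrite lt_min ltr01.
have mu1 : mu <= 1 by rewrite ge_min lexx.
have mue : mu <= eps by rewrite ge_min lexx orbT.
pose delta := mu / T.
have delta0 : 0 < delta by rewrite divr_gt0 //; lra.
have delta1 : delta <= 1 by rewrite ler_pdivrMr; lra.
have lgdelta : lg (1 / delta) <= t x + x.
  have -> : 1 / delta = T * (1 / mu) by rewrite /delta; field; lra.
  have := lgM (lt_le_trans ltr01 T1) (divr_gt0 ltr01 mu0).
  have := lg_inv_min1 eps0; rewrite lg_powR2 // -/mu -/e; lra.
have dT : delta * T = mu by rewrite divfK //; lra.
have D_C (c' : nat) : (c' <= C)%N -> (c' * d <= D)%N by rewrite leq_mul2r orbC => ->.
have A1 : 1 <= A x by rewrite -(powRr0 2) ler_powR ?mulr_ge0 ?exprn_ge0 //; lra.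
(* One half of [eps] goes to the [P1]-proof, the other to the error of the transfer. *)
have -> : q + eps%:MP = (q + (eps / 2)%:MP) + (eps / 2)%:MP.
  by rewrite -addrA -mpolyCD; congr (_ + _%:MP); field.
apply: (sos_proof_le (leqnn _) (Fc x x1)).
rewrite !mulnDl -/D.
have B0 : 0 <= B x by exact: powR_ge0.
have W0 : 0 <= W x by exact: powR_ge0.
have U1 : 1 <= A x + 1 by lra.
apply: (sos_proof_transfer A1 U1 W0 (ltW delta0) delta1 B0).
(* (D + 1)^n <= 2^(D n), since D + 1 <= 2^D. *)
- apply: (@le_trans _ _ (2 `^ (D * n)%:R)).
    by rewrite powR_mulrn // -natrX ler_nat expnM leq_exp2r // ltn_expl.
  by apply: ler_powR; [lra|rewrite natrM ler_wpM2l //; lra].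
- by apply: le_trans sP1 (poly_bound_le _ _ _); rewrite big_seq1 //; lra.
- move=> i; have [N [/andP[_ NB]]] := arch i.
  have BA : 2 `^ poly_bound ca [:: E] <= A x.
    apply: ler_powR; first lra.
    by apply: poly_bound_le; rewrite big_seq1 //; lra.
  (* The Archimedean bound [N] depends on [i]; adding the constant [A x - N] makes it uniform and
     raises the coefficient bound by 1. *)
  have -> : (A x)%:MP - 'X_i ^+ 2 =
      N%:MP - 'X_i ^+ 2 + (A x - N)%:MP :> {mpoly R[n]}.
    by rewrite mpolyCB; ring.
  move=> pf; apply: sos_proofD => //; first exact: powR_ge0.
    by apply: sos_proof_le pf => //; exact: D_C.
  by apply: sos_proofC => //; rewrite subr_ge0; exact: le_trans NB BA.
- move=> p pP; have /= := le12 p pP delta delta0.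
  have BW : 2 `^ poly_bound cl [:: E; lg (1 / delta)] <= W x.
    apply: ler_powR; first lra.
    have lg0 := lg_ge0 (1 / delta).
    by apply: poly_bound_le; rewrite !big_cons big_nil; lra.
  have ClD : (Cl * d <= D)%N by exact: D_C.
  by move=> [Pp Pn]; split; apply: (sos_proof_le ClD BW).
(* delta * G x <= delta * T = mu <= eps. *)
- rewrite ler_pM2r ?invr_gt0 ?ltr0n //; apply: le_trans mue.
  by rewrite -dT ler_pM2l //; exact: Gk.
- have C1D : (C1 * d <= D)%N by exact: D_C.
  apply: sos_proof_le C1D _ cpl; apply: ler_powR; first lra.
  have lg2 : lg (1 / (eps / 2)) <= 1 + e.
    have -> : 1 / (eps / 2) = 2 `^ 1 * (1 / eps) by rewrite powRr1 //; field; lra.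
    have := lgM (powR_gt0 1 (ltr0Sn R 1)) (divr_gt0 ltr01 eps0).
    by rewrite lg_powR2.
  have lg0 := lg_ge0 (1 / (eps / 2)).
  by apply: poly_bound_le; rewrite !big_cons big_nil; lra.
Qed.
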